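(* Consider an admissible kernel $K=K(x,y)$ defined on an open set $\Omega\subset\mathbb{R}^D$. Then, for any function $\varphi$ in the Hilbert space $\mathcal{H}_K(\Omega)$, one has $$\Big|\int_\Omega\varphi(x)\,dx-\frac1N\sum_{1\le n\le N}\varphi(y^n)\Big|\le E_K(Y,N,D)\,\|\varphi\|_{\mathcal{H}_K(\Omega)}$$ for any set $Y=(y^1,\dots,y^N)$ of points in $\Omega$, with the error function $$E_K(Y,N,D)^2:=\frac1{N^2}\sum_{n,m=1}^N\iint_{\Omega\times\Omega}\Big(K(x,y)+K(y^n,y^m)-K(y^n,y)-K(x,y^m)\Big)\,dx\,dy$$ or, equivalently, $$E_K(Y,N,D)=\|e_K(Y)\|_{\mathcal{H}_K(\Omega)},\qquad e_K(Y):=\int_\Omega\Big(K(\cdot,x)-\frac1N\sum_{1\le n\le N}K(\cdot,y^n)\Big)\,dx.$$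
   Context: An admissible kernel on a bounded open set $\Omega\subset\mathbb{R}^D$ is a bounded and continuous function $K:\Omega\times\Omega\to\mathbb{R}$ which is symmetric ($K(x,y)=K(y,x)$) and such that, for any collection of distinct points $y^1,\dots,y^N\in\Omega$, the matrix $(K(y^m,y^n))_{1\le n,m\le N}$ is positive definite, i.e. $\sum_{n,m}a_na_mK(y^n,y^m)>0$ for all $a\in\mathbb{R}^N\setminus\{0\}$. The space $\mathcal{H}_K(\Omega)$ is the reproducing kernel Hilbert space generated by $K$: the completion of the span of $\{K(\cdot,x):x\in\Omega\}$ for the inner product determined by $\langle K(\cdot,x),K(\cdot,y)\rangle_{\mathcal{H}_K(\Omega)}=K(x,y)$. Its elements are continuous functions on $\Omega$ satisfying $\varphi(x)=\langle\varphi,K(\cdot,x)\rangle_{\mathcal{H}_K(\Omega)}$.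
   Formalization: The inequality as written fails when |Ω| ≠ 1; it is stated literally for |Ω| = 1, and for every bounded open Ω with (1/N)Σφ(y^n) replaced by (|Ω|/N)Σφ(y^n), the error function E_K and E_K = ‖e_K(Y)‖ being unchanged. *)

(* Defs.v *)
From HB Require Import structures.
From mathcomp Require Import all_boot all_order all_algebra.
From mathcomp Require Import all_classical all_reals all_analysis.
Export numFieldNormedType.Exports.

Set Implicit Arguments.
Unset Strict Implicit.
Unset Printing Implicit Defensive.
Import Order.TTheory GRing.Theory Num.Theory.
Local Open Scope classical_set_scope.
Local Open Scope ring_scope.

(* The sigma-algebra on R^n is generated by the coordinate maps; it is the
   Borel sigma-algebra of the topology of 'rV[R]_n. *)
Section measurable_row.
Context {R : realType} {n : nat}.

Let coor (i : 'I_n) (v : 'rV[R]_n) : measurableTypeR R := v ord0 i.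

Let row_set0 : g_sigma_preimage coor set0.
Proof. exact: sigma_algebra0. Qed.

Let row_setC A : g_sigma_preimage coor A -> g_sigma_preimage coor (~` A).
Proof. exact: sigma_algebraC. Qed.

Let row_bigcup (F : _^nat) : (forall i, g_sigma_preimage coor (F i)) ->
  g_sigma_preimage coor (\bigcup_i (F i)).
Proof. exact: sigma_algebra_bigcup. Qed.

HB.instance Definition _ := @isMeasurable.Build default_measure_display
  'rV[R]_n (g_sigma_preimage coor) row_set0 row_setC row_bigcup.

End measurable_row.

Lemma measurable_coor (R : realType) n (i : 'I_n) :
  measurable_fun [set: 'rV[R]_n] (fun v => v ord0 i : measurableTypeR R).
Proof.
move=> _ Y mY; rewrite setTI; apply: sub_sigma_algebra => /=.
rewrite -bigcup_seq/=; exists i => /=; first by rewrite mem_index_enum.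
by exists Y => //; rewrite setTI.
Qed.

Lemma measurable_fun_row d (T : measurableType d) (R : realType) n
    (f : T -> 'rV[R]_n) :
  (forall i, measurable_fun [set: T] (fun x => f x ord0 i : measurableTypeR R)) ->
  measurable_fun [set: T] f.
Proof.
move=> mf; apply: (measurability
  (\big[setU/set0]_(i < n) preimage_set_system [set: 'rV[R]_n]
     (fun v : 'rV[R]_n => v ord0 i : measurableTypeR R) measurable)) => //.
move=> _ [B + <-]; rewrite -bigcup_seq => -[i _ [C mC <-]].
by rewrite !setTI; have := mf i measurableT C mC; rewrite setTI.
Qed.

Section lebesgue_row.
Context {R : realType}.

Definition rcons_row n (p : 'rV[R]_n * measurableTypeR R) : 'rV[R]_n.+1 :=
  \row_(i < n.+1) if unlift ord_max i is Some j then p.1 ord0 j else p.2.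

Definition belast_row n (v : 'rV[R]_n.+1) : 'rV[R]_n * measurableTypeR R :=
  (\row_(i < n) v ord0 (lift ord_max i), v ord0 ord_max).

Lemma rcons_rowK n : cancel (@rcons_row n) (@belast_row n).
Proof.
case=> v a; rewrite /belast_row mxE unlift_none; congr pair.
by apply/rowP => i; rewrite !mxE liftK.
Qed.

Lemma measurable_rcons_row n : measurable_fun setT (@rcons_row n).
Proof.
apply: measurable_fun_row => i; case: (unliftP ord_max i) => [j|] ->.
- rewrite (_ : (fun _ => _) = (fun v : 'rV[R]_n => v ord0 j : measurableTypeR R)
    \o fst); last by apply/funext => p /=; rewrite mxE liftK.
  by apply: measurableT_comp => //; exact: measurable_coor.
- rewrite (_ : (fun _ => _) = snd); first exact: measurable_snd.
  by apply/funext => p /=; rewrite mxE unlift_none.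
Qed.

Lemma measurable_belast_row n : measurable_fun setT (@belast_row n).
Proof.
apply/measurable_fun_pairP; split; last exact: measurable_coor.
apply: measurable_fun_row => i.
rewrite (_ : (fun _ => _) = (fun v : 'rV[R]_n.+1 =>
    v ord0 (lift ord_max i) : measurableTypeR R)); first exact: measurable_coor.
by apply/funext => v /=; rewrite mxE.
Qed.

Section extend_row.
Variables (n : nat) (mu : {sigma_finite_measure set 'rV[R]_n -> \bar R}).

Definition extend_row : set 'rV[R]_n.+1 -> \bar R :=
  pushforward (mu \x @lebesgue_measure R)%E (@rcons_row n).

Let extend_row0 : extend_row set0 = 0%E.
Proof. by rewrite /extend_row /pushforward preimage_set0 measure0. Qed.

Let extend_row_ge0 A : (0 <= extend_row A)%E.
Proof. by rewrite /extend_row /pushforward; exact: measure_ge0. Qed.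

Let extend_row_sigma_additive : semi_sigma_additive extend_row.
Proof.
have mf A : measurable A -> measurable (@rcons_row n @^-1` A).
  by move=> mA; rewrite -[X in measurable X]setTI; exact: measurable_rcons_row.
move=> F mF /trivIsetP tF mUF; rewrite /extend_row /pushforward preimage_bigcup.
apply: measure_semi_sigma_additive.
- by move=> k; exact: mf.
- by apply/trivIsetP => i j _ _ ij; rewrite -preimage_setI tF ?preimage_set0.
- by rewrite -preimage_bigcup; exact: mf.
Qed.

HB.instance Definition _ := isMeasure.Build _ _ _ extend_row
  extend_row0 extend_row_ge0 extend_row_sigma_additive.

Let extend_row_sigma_finite : sigma_finite setT extend_row.
Proof.
have /sigma_finiteP[F [TF ndF mF]] := sigma_finiteT mu.
have /sigma_finiteP[G [TG ndG mG]] := sigma_finiteT (@lebesgue_measure R).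
exists (fun k => @belast_row n @^-1` (F k `*` G k)).
  rewrite -preimage_bigcup (_ : \bigcup_k _ = setT) ?preimage_setT//.
  apply/seteqP; split=> // -[v a] _.
  have [i _ Fv] : (\bigcup_i F i) v by rewrite -TF.
  have [j _ Ga] : (\bigcup_i G i) a by rewrite -TG.
  exists (maxn i j) => //; split.
  - by move: v Fv; exact/subsetPset/ndF/leq_maxl.
  - by move: a Ga; exact/subsetPset/ndG/leq_maxr.
move=> k; have [mFk Fk] := mF k; have [mGk Gk] := mG k.
have mFG : measurable (F k `*` G k) by exact: measurableX.
split.
  by rewrite -[X in measurable X]setTI; exact: measurable_belast_row.
rewrite /extend_row /pushforward -comp_preimage (_ : _ \o _ = id); last first.
  by apply/funext; exact: rcons_rowK.
by rewrite preimage_id product_measure1E// lte_mul_pinfty// ge0_fin_numE.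
Qed.

HB.instance Definition _ := Measure_isSigmaFinite.Build _ _ _ extend_row
  extend_row_sigma_finite.

End extend_row.

(* Lebesgue measure on R^n, as the n-fold product of that of R. *)
Fixpoint lebesgue_row n : {sigma_finite_measure set 'rV[R]_n -> \bar R} :=
  if n is m.+1 then extend_row (lebesgue_row m) else \d_(0 : 'rV[R]_0).

End lebesgue_row.
Arguments lebesgue_row {R} n.

(* A kernel on Omega is given by a total function, whose values outside
   Omega * Omega are never used; similarly for functions on Omega. *)
Record admissible {R : realType} {D : nat} (Omega : set 'rV[R]_D)
    (K : 'rV[R]_D -> 'rV[R]_D -> R) : Prop := Admissible {
  admissible_bounded :
    exists M, forall x y, Omega x -> Omega y -> `|K x y| <= M ;
  admissible_continuous :
    {within Omega `*` Omega, continuous (fun p => K p.1 p.2)} ;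
  admissible_sym : forall x y, Omega x -> Omega y -> K x y = K y x ;
  admissible_posdef : forall (N : nat) (y : 'I_N -> 'rV[R]_D),
    injective y -> (forall n, Omega (y n)) ->
    forall a : 'I_N -> R, (exists n, a n != 0) ->
    0 < \sum_n \sum_m a n * a m * K (y n) (y m) }.

(* The space H_K(Omega). The list [:: (a_1, x_1); ...; (a_k, x_k)] stands for
   the combination \sum_i a_i K(., x_i). The completion of the span is realised
   as a space of functions: the class of a Cauchy sequence of combinations is
   identified with its limit phi(x) = lim_n <u_n, K(., x)> = lim_n u_n(x). *)
Section rkhs.
Context {R : realType} {D : nat}.
Variables (Omega : set 'rV[R]_D) (K : 'rV[R]_D -> 'rV[R]_D -> R).
Implicit Types (s t : seq (R * 'rV[R]_D)) (phi psi : 'rV[R]_D -> R).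

Definition in_span s := forall p, p \in s -> Omega p.2.

Definition comb_fun s : 'rV[R]_D -> R := fun z => \sum_(p <- s) p.1 * K z p.2.

Definition comb_dot s t : R :=
  \sum_(p <- s) \sum_(q <- t) p.1 * q.1 * K p.2 q.2.

Definition comb_sub s t := s ++ [seq (- p.1, p.2) | p <- t].

Definition comb_norm s : R := Num.sqrt (comb_dot s s).

Definition represents (u : nat -> seq (R * 'rV[R]_D)) phi :=
  [/\ forall n, in_span (u n),
      forall e, 0 < e -> exists n0, forall m n, (n0 <= m)%N -> (n0 <= n)%N ->
        comb_norm (comb_sub (u m) (u n)) < e &
      forall z, Omega z -> comb_fun (u n) z @[n --> \oo] --> phi z].

Definition rkhs : set ('rV[R]_D -> R) := [set phi | exists u, represents u phi].

(* The limit exists and does not depend on the representing sequences when K is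
   admissible. *)
Definition rkhs_dot phi psi : R :=
  get [set r : R | exists u v, [/\ represents u phi, represents v psi &
    comb_dot (u n) (v n) @[n --> \oo] --> r]].

Definition rkhs_norm phi : R := Num.sqrt (rkhs_dot phi phi).

End rkhs.

Section quadrature_error.
Context {R : realType} {D : nat}.
Variables (Omega : set 'rV[R]_D) (K : 'rV[R]_D -> 'rV[R]_D -> R).
Variables (N : nat) (y : 'I_N -> 'rV[R]_D).
Local Notation mu := (lebesgue_row D).

Definition E_K_sq : R := (N%:R ^+ 2)^-1 * \sum_n \sum_m
  \int[(mu \x mu)%E]_(p in Omega `*` Omega)
    (K p.1 p.2 + K (y n) (y m) - K (y n) p.2 - K p.1 (y m)).

Definition E_K : R := Num.sqrt E_K_sq.

(* Since the constant term is integrated over Omega, pairing phi with e_K gives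
   \int_Omega phi - (|Omega| / N) \sum_n phi (y n); the usual mean of the
   phi (y n) appears when |Omega| = 1. *)
Definition e_K : 'rV[R]_D -> R := fun z =>
  \int[mu]_(x in Omega) (K z x - N%:R^-1 * \sum_n K z (y n)).

End quadrature_error.

(* Main.v *)
Require Import Defs.
From mathcomp Require Import all_boot all_order all_algebra.
From mathcomp Require Import all_classical all_reals all_analysis.
From mathcomp Require Import measurable_realfun ring lra.
Import Order.TTheory GRing.Theory Num.Theory.
Set Implicit Arguments.
Unset Strict Implicit.
Unset Printing Implicit Defensive.
Local Open Scope classical_set_scope.
Local Open Scope ring_scope.

(** The quadrature error L(phi) = int_Omega phi - |Omega| (1/N) sum_n phi(y^n)
is linear in phi, and by the symmetry of K its value at the section K(., x) is
e_K(x) ([quad_err_kernel]). On combinations s of sections L is bounded for the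
norm of H_K, since |s(x)| <= ||s|| sqrt(K(x, x)) and Omega has finite measure.
So e_K is the Riesz representer of L: it lies in H_K, |L(phi)| is at most
||e_K|| ||phi||, and L(e_K) = ||e_K||^2. Expanding L(e_K) with Fubini's theorem
gives the double integral E_K^2 ([E_K_sqE]).

The elements of H_K are limits of Cauchy sequences (u_n) of combinations, and
most facts about them come from one estimate ([represents_dot_uniform]): when u
represents phi, the functionals <u_n, .> converge to the linear extension of
phi uniformly on the unit ball of combinations. Applied to u_n - v_n it shows
that the norm does not depend on the representing sequence, applied to sections
it gives uniform convergence on Omega (as K is bounded), whence L(u_n) -->
L(phi), and applied to u_n itself it shows that phi(u_n) --> ||phi||^2.

The representer is found by minimising ||s||^2 - 2 L(s) over the combinations
([riesz_rkhs]): along a minimising sequence, the discriminant of the quadratic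
t |-> ||u_n + t s||^2 - 2 L(u_n + t s) bounds <u_n, s> - L(s) by a null sequence
times ||s||, so that the sequence is Cauchy and represents the function
x |-> L(K(., x)) = e_K(x).

The integrals make sense because open sets are countable unions of balls with
rational centres, so that K is measurable on Omega x Omega, and because Omega
lies in a box, of finite Lebesgue measure. *)

(** * Combinations of kernel sections *)

Section Combinations.
Context {R : realType} {D : nat}.
Implicit Types (s t : seq (R * 'rV[R]_D)) (l : 'rV[R]_D -> R) (c : R).
Implicit Types (Omega : set 'rV[R]_D) (K : 'rV[R]_D -> 'rV[R]_D -> R).

(** The linear extension to combinations of a function given on points. Every
pairing below has this form: u |-> u(z) extends K(z, .), and <., t> extends the
function t ([comb_dotE]). *)
Definition lin_ext l s : R := \sum_(p <- s) p.1 * l p.2.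
Definition comb_scale c s := [seq (c * p.1, p.2) | p <- s].

Lemma lin_ext_cat l s t : lin_ext l (s ++ t) = lin_ext l s + lin_ext l t.
Proof. by rewrite /lin_ext big_cat. Qed.

Lemma lin_ext_scale l c s : lin_ext l (comb_scale c s) = c * lin_ext l s.
Proof. by rewrite /lin_ext big_map mulr_sumr; apply: eq_bigr => p _; rewrite mulrA. Qed.

Lemma lin_ext_sub l s t : lin_ext l (comb_sub s t) = lin_ext l s - lin_ext l t.
Proof.
rewrite /comb_sub lin_ext_cat /lin_ext big_map -sumrN; congr (_ + _).
by apply: eq_bigr => p _; rewrite mulNr.
Qed.

Lemma lin_extD (l1 l2 : 'rV[R]_D -> R) s :
  lin_ext (fun x => l1 x + l2 x) s = lin_ext l1 s + lin_ext l2 s.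
Proof. by rewrite /lin_ext -big_split; apply: eq_bigr => p _; rewrite mulrDr. Qed.

Lemma lin_extZ l c s : lin_ext (fun x => c * l x) s = c * lin_ext l s.
Proof. by rewrite /lin_ext mulr_sumr; apply: eq_bigr => p _; rewrite mulrCA. Qed.

Lemma in_span_cat Omega s t : in_span Omega s -> in_span Omega t ->
  in_span Omega (s ++ t).
Proof. by move=> sO tO p; rewrite mem_cat => /orP[/sO|/tO]. Qed.

Lemma in_span_scale Omega c s : in_span Omega s -> in_span Omega (comb_scale c s).
Proof. by move=> sO _ /mapP[p /sO pO ->]. Qed.

Lemma in_span_sub Omega s t : in_span Omega s -> in_span Omega t ->
  in_span Omega (comb_sub s t).
Proof. by move=> sO tO; apply: in_span_cat => // _ /mapP[p /tO pO ->]. Qed.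

Lemma comb_dotE K s t : comb_dot K s t = lin_ext (comb_fun K t) s.
Proof.
apply: eq_bigr => p _; rewrite mulr_sumr; apply: eq_bigr => q _.
by rewrite mulrA.
Qed.

Lemma comb_dotC Omega K s t : admissible Omega K ->
  in_span Omega s -> in_span Omega t -> comb_dot K s t = comb_dot K t s.
Proof.
move=> K_adm sO tO; rewrite /comb_dot exchange_big /=.
apply: eq_big_seq => q qt; apply: eq_big_seq => p ps.
by rewrite (admissible_sym K_adm (sO _ ps) (tO _ qt)) (mulrC p.1).
Qed.

Lemma comb_dotDl K s1 s2 t :
  comb_dot K (s1 ++ s2) t = comb_dot K s1 t + comb_dot K s2 t.
Proof. by rewrite !comb_dotE lin_ext_cat. Qed.

Lemma comb_dotZl K c s t : comb_dot K (comb_scale c s) t = c * comb_dot K s t.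
Proof. by rewrite !comb_dotE lin_ext_scale. Qed.

Lemma comb_dotBl K s1 s2 t :
  comb_dot K (comb_sub s1 s2) t = comb_dot K s1 t - comb_dot K s2 t.
Proof. by rewrite !comb_dotE lin_ext_sub. Qed.

Lemma comb_dotDr K s t1 t2 :
  comb_dot K s (t1 ++ t2) = comb_dot K s t1 + comb_dot K s t2.
Proof.
by rewrite !comb_dotE -lin_extD; apply: eq_bigr => p _;
  rewrite [comb_fun _ _ _]lin_ext_cat.
Qed.

Lemma comb_dotZr K c s t : comb_dot K s (comb_scale c t) = c * comb_dot K s t.
Proof.
by rewrite !comb_dotE -lin_extZ; apply: eq_bigr => p _;
  rewrite [comb_fun _ _ _]lin_ext_scale.
Qed.

Lemma comb_dotBr K s t1 t2 :
  comb_dot K s (comb_sub t1 t2) = comb_dot K s t1 - comb_dot K s t2.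
Proof.
rewrite !comb_dotE -mulN1r -lin_extZ -lin_extD; apply: eq_bigr => p _.
by rewrite [comb_fun _ _ _]lin_ext_sub mulN1r.
Qed.

(** A combination may repeat points; collecting the coefficients of each point
brings it to the distinct points for which positive definiteness is assumed. *)
Lemma lin_ext_group l s : let X := undup [seq p.2 | p <- s] in
  lin_ext l s = \sum_(i < size X) (\sum_(p <- s | p.2 == tnth (in_tuple X) i) p.1)
                                * l (tnth (in_tuple X) i).
Proof.
move=> X; rewrite -(big_tnth _ _ X predT
  (fun x => (\sum_(p <- s | p.2 == x) p.1) * l x)) /lin_ext.
rewrite (eq_bigr (fun x => \sum_(p <- s | p.2 == x) p.1 * l p.2)); last first.
  by move=> x _; rewrite mulr_suml; apply: eq_bigr => p /eqP ->.
rewrite (exchange_big_dep predT) //=; apply: eq_big_seq => p ps.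
rewrite -big_filter.
have -> : [seq x <- X | p.2 == x] = [:: p.2].
  rewrite (eq_filter (a2 := pred1 p.2)); last by move=> x /=; rewrite eq_sym.
  by rewrite filter_pred1_uniq ?undup_uniq // mem_undup map_f.
by rewrite big_seq1.
Qed.

(** After collection either all coefficients vanish or positive definiteness
applies. *)
Lemma comb_dot_ge0 Omega K s : admissible Omega K -> in_span Omega s ->
  0 <= comb_dot K s s.
Proof.
move=> K_adm sO; set X := undup [seq p.2 | p <- s].
pose a i := \sum_(p <- s | p.2 == tnth (in_tuple X) i) p.1.
have -> : comb_dot K s s = \sum_i \sum_j a i * a j *
    K (tnth (in_tuple X) i) (tnth (in_tuple X) j).
  rewrite comb_dotE lin_ext_group; apply: eq_bigr => i _.
  rewrite [comb_fun _ _ _]lin_ext_group mulr_sumr; apply: eq_bigr => j _.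
  by rewrite mulrA.
have [a0|/forallPn[i ai]] := boolP [forall i, a i == 0].
  rewrite big1 // => i _; rewrite big1 // => j _.
  by rewrite (eqP (forallP a0 i)) !mul0r.
apply/ltW/(admissible_posdef K_adm).
- by apply/tuple_uniqP/undup_uniq.
- move=> n; have := mem_tnth n (in_tuple X).
  by rewrite /= mem_undup => /mapP[p /sO pO ->].
- by exists i.
Qed.

End Combinations.

(** * The Hilbert space of the kernel *)

(** Non-strict discriminant inequality. The degenerate case a = 0 matters: the
form is only known to be semidefinite on lists of points. *)
Lemma discriminant_le (R : realFieldType) (a b c : R) : 0 <= a ->
  (forall t, 0 <= a * t ^+ 2 + 2 * b * t + c) -> b ^+ 2 <= a * c.
Proof.
move=> a0 H; have [a_eq0|an0] := eqVneq a 0.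
  rewrite a_eq0 mul0r in H *; have [->|bn0] := eqVneq b 0; first by rewrite expr0n.
  (* The value of t at which 2 b t + c equals -1. *)
  have := H (- (c + 1) / (2 * b)).
  have -> : 0 * (- (c + 1) / (2 * b)) ^+ 2 + 2 * b * (- (c + 1) / (2 * b)) + c
    = -1 by field.
  by rewrite ler0N1.
(* The trinomial is minimal at t = - b / a. *)
have := H (- b / a).
have -> : a * (- b / a) ^+ 2 + 2 * b * (- b / a) + c = (a * c - b ^+ 2) / a by field.
by rewrite pmulr_lge0 ?invr_gt0 ?lt_def ?an0 // subr_ge0.
Qed.

Section Hilbert.
Context {R : realType} {D : nat}.
Variables (Omega : set 'rV[R]_D) (K : 'rV[R]_D -> 'rV[R]_D -> R).
Hypothesis K_adm : admissible Omega K.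
Implicit Types (s t : seq (R * 'rV[R]_D)) (l phi : 'rV[R]_D -> R).
Local Notation dot := (comb_dot K).
Local Notation nrm := (comb_norm K).
Local Notation span := (in_span Omega).

Lemma comb_norm_ge0 s : 0 <= nrm s.
Proof. exact: sqrtr_ge0. Qed.

Lemma sqr_comb_norm s : span s -> nrm s ^+ 2 = dot s s.
Proof. by move=> sO; rewrite sqr_sqrtr // (comb_dot_ge0 K_adm). Qed.

Lemma comb_CauchySchwarz s t : span s -> span t -> `|dot s t| <= nrm s * nrm t.
Proof.
move=> sO tO; rewrite -(ler_sqr (normr_ge0 _)) ?nnegrE ?mulr_ge0 ?comb_norm_ge0 //.
rewrite exprMn !sqr_comb_norm // real_normK ?num_real // mulrC.
apply: discriminant_le => [|c]; first exact: comb_dot_ge0 K_adm _.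
have := comb_dot_ge0 K_adm (in_span_cat sO (in_span_scale (c := c) tO)).
rewrite comb_dotDl !comb_dotDr comb_dotZl !comb_dotZr comb_dotZl.
rewrite (comb_dotC K_adm tO sO).
move: (dot s s) (dot s t) (dot t t) => x z w H.
by rewrite (_ : _ + _ = x + c * z + (c * z + c * (c * w))) //; ring.
Qed.

Lemma comb_norm_subC s t : nrm (comb_sub s t) = nrm (comb_sub t s).
Proof. by congr Num.sqrt; rewrite !comb_dotBl !comb_dotBr opprB [RHS]addrC opprB. Qed.

Lemma comb_norm_le_sub s t : span s -> span t -> nrm s <= nrm (comb_sub s t) + nrm t.
Proof.
move=> sO tO; have [s0|sn0] := eqVneq (nrm s) 0.
  by rewrite s0 addr_ge0 // comb_norm_ge0.
have s0 : 0 < nrm s by rewrite lt_def sn0 comb_norm_ge0.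
rewrite -(ler_pM2l s0) -expr2 sqr_comb_norm // mulrDr.
have -> : dot s s = dot s (comb_sub s t) + dot s t.
  by rewrite comb_dotBr subrK.
apply: lerD; apply: le_trans (ler_norm _) _; apply: comb_CauchySchwarz => //.
exact: in_span_sub.
Qed.

Lemma comb_norm_dist s t : span s -> span t ->
  `|nrm s - nrm t| <= nrm (comb_sub s t).
Proof.
move=> sO tO; rewrite ler_norml.
have := comb_norm_le_sub sO tO; have := comb_norm_le_sub tO sO.
by rewrite (comb_norm_subC t); lra.
Qed.

(** The reproducing property. *)
Lemma comb_fun_dot s z : span s -> Omega z -> comb_fun K s z = dot s [:: (1, z)].
Proof.
move=> sO zO; rewrite comb_dotE; apply: eq_big_seq => p /sO pO.
by rewrite /comb_fun big_seq1 mul1r (admissible_sym K_adm).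
Qed.

Lemma represents_dot_cvg u phi t : represents Omega K u phi -> span t ->
  dot (u n) t @[n --> \oo] --> lin_ext phi t.
Proof.
case=> uO _ uphi tO.
rewrite (_ : (fun n => _) = (fun n => \sum_(p <- t) p.1 * comb_fun K (u n) p.2)).
  rewrite /lin_ext big_seq; under eq_cvg do rewrite big_seq.
  apply: cvg_big => [|p pt]; first exact: add_continuous.
  by apply: cvgM; [exact: cvg_cst|exact/uphi/tO].
by apply/funext => n; rewrite (comb_dotC K_adm) // comb_dotE.
Qed.

(** Cauchy-Schwarz bounds <u_n - u_m, t> by e ||t|| with a rank depending only on
e; then m goes to infinity. *)
Lemma represents_dot_uniform u phi : represents Omega K u phi -> forall e, 0 < e ->
  \forall n \near \oo, forall t, span t -> `|dot (u n) t - lin_ext phi t| <= e * nrm t.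
Proof.
move=> uphi e e0; have [uO uC _] := uphi; have [n0 Hn0] := uC e e0.
exists n0 => // n /= n0n t tO.
have cv : dot (u n) t - dot (u m) t @[m --> \oo] --> dot (u n) t - lin_ext phi t.
  by apply: cvgB; [exact: cvg_cst|exact: represents_dot_cvg].
apply: (cvgr_to_le (cvg_norm cv)); exists n0 => // m /= n0m; rewrite -comb_dotBl.
apply: le_trans (comb_CauchySchwarz _ tO) _; first exact: in_span_sub.
by rewrite ler_wpM2r ?comb_norm_ge0 // ltW // Hn0.
Qed.

Lemma represents_uniform u phi M :
  (forall x, Omega x -> K x x <= M) -> represents Omega K u phi ->
  forall e, 0 < e ->
  \forall n \near \oo, forall z, Omega z -> `|comb_fun K (u n) z - phi z| <= e.
Proof.
move=> KM uphi e e0.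
have d0 : 0 < e / (Num.sqrt M + 1).
  by rewrite divr_gt0 // ltr_wpDl ?sqrtr_ge0.
have uO := let: And3 uO _ _ := uphi in uO.
have := represents_dot_uniform uphi d0; apply: filterS => n H z zO.
have zs : span [:: (1, z)] by move=> p; rewrite inE => /eqP ->.
have -> : phi z = lin_ext phi [:: (1, z)] by rewrite /lin_ext big_seq1 mul1r.
rewrite comb_fun_dot //; apply: le_trans (H _ zs) _.
rewrite -mulrA ger_pMr // mulrC ler_pdivrMr ?ltr_wpDl ?sqrtr_ge0 // mul1r.
rewrite ler_wpDr // /comb_norm /comb_dot !big_seq1 !mul1r.
exact/ler_wsqrtr/KM.
Qed.

(** Both <u_n, .> and <v_n, .> are close to the same functional, uniformly on the
unit ball, so w = u_n - v_n satisfies ||w||^2 = <w, w> <= e ||w||. *)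
Lemma represents_sub0 u v phi : represents Omega K u phi ->
  represents Omega K v phi -> nrm (comb_sub (u n) (v n)) @[n --> \oo] --> 0.
Proof.
move=> uphi vphi; apply/cvgrPdist_le => e e0.
have [[uO _ _] [vO _ _]] := (uphi, vphi).
have e20 : 0 < e / 2 by rewrite divr_gt0.
near=> n; rewrite sub0r normrN ger0_norm ?comb_norm_ge0 //.
set w := comb_sub _ _; have wO : span w by exact: in_span_sub.
have [->|wn0] := eqVneq (nrm w) 0; first exact: ltW.
have w0 : 0 < nrm w by rewrite lt_def wn0 comb_norm_ge0.
rewrite -(ler_pM2r w0) -expr2 sqr_comb_norm // {1}/w comb_dotBl.
have -> : dot (u n) w - dot (v n) w =
    (dot (u n) w - lin_ext phi w) - (dot (v n) w - lin_ext phi w).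
  by rewrite opprB addrA subrK.
apply: le_trans (ler_norm _) _; apply: le_trans (ler_normB _ _) _.
rewrite [e in leRHS]splitr mulrDl; apply: lerD; move: w wO {wn0 w0};
  near: n; exact: represents_dot_uniform.
Unshelve. all: by end_near. Qed.

Lemma represents_norm_cvg u phi : represents Omega K u phi ->
  cvgn (fun n => nrm (u n)).
Proof.
case=> uO uC _; apply/cauchy_cvgP/cauchy_exP => e e0.
have [n0 un0] := uC e e0; exists (nrm (u n0)); exists n0 => // n /= n0n.
apply: le_lt_trans (un0 n0 n _ n0n) => //.
exact: comb_norm_dist _ _ (uO _) (uO _).
Qed.

Lemma represents_dot_sub_norm u v w phi : represents Omega K u phi ->
  represents Omega K v phi -> represents Omega K w phi ->
  dot (v n) (w n) - nrm (u n) ^+ 2 @[n --> \oo] --> 0.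
Proof.
move=> uphi vphi wphi.
have [[uO _ _] [vO _ _] [wO _ _]] := And3 uphi vphi wphi.
have cvgB0 : nrm (comb_sub (v n) (u n)) * nrm (w n) +
    nrm (u n) * nrm (comb_sub (w n) (u n)) @[n --> \oo] --> 0.
  rewrite -[X in _ --> X]addr0; apply: cvgD.
    rewrite -(mul0r (limn (fun n => nrm (w n)))); apply: cvgM.
      exact: represents_sub0 uphi.
    exact: represents_norm_cvg wphi.
  rewrite -(mulr0 (limn (fun n => nrm (u n)))); apply: cvgM.
    exact: represents_norm_cvg uphi.
  exact: represents_sub0 uphi.
apply: norm_cvg0; apply: squeeze_cvgr _ (cvg_cst 0) cvgB0.
near=> n; rewrite normr_ge0 /= sqr_comb_norm //.
have -> : dot (v n) (w n) - dot (u n) (u n) =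
    dot (comb_sub (v n) (u n)) (w n) + dot (u n) (comb_sub (w n) (u n)).
  by rewrite comb_dotBl comb_dotBr addrA subrK.
apply: le_trans (ler_normD _ _) _.
by apply: lerD; apply: comb_CauchySchwarz _ _ _ _ => //; exact: in_span_sub.
Unshelve. all: by end_near. Qed.

(** The dot product of phi with itself is a chosen limit, possibly of two
sequences other than u; [represents_dot_sub_norm] makes every choice agree. *)
Lemma represents_norm u phi : represents Omega K u phi ->
  nrm (u n) @[n --> \oo] --> rkhs_norm Omega K phi.
Proof.
move=> uphi; have cu := represents_norm_cvg uphi.
set L := limn (fun n => nrm (u n)) in cu.
have L0 : 0 <= L by apply: limr_ge cu _; near=> n; exact: comb_norm_ge0.
have cu2 : nrm (u n) ^+ 2 @[n --> \oo] --> L ^+ 2 by rewrite !expr2; exact: cvgM.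
have : [set r : R | exists u v, [/\ represents Omega K u phi,
    represents Omega K v phi & dot (u n) (v n) @[n --> \oo] --> r]] (L ^+ 2).
  exists u, u; split => //.
  rewrite (_ : (fun n => _) = (fun n => nrm (u n) ^+ 2)) //.
  by apply/funext => n; rewrite sqr_comb_norm //; case: uphi.
move=> /getI.
rewrite /rkhs_norm /rkhs_dot; set r := get _ => -[v [w [vphi wphi cvw]]].
have -> : r = L ^+ 2.
  have cvL : dot (v n) (w n) @[n --> \oo] --> L ^+ 2.
    rewrite -[L ^+ 2]add0r.
    under eq_cvg => n do rewrite -(subrK (nrm (u n) ^+ 2) (dot _ _)).
    exact: cvgD (represents_dot_sub_norm uphi vphi wphi) cu2.
  exact: (cvg_unique (@norm_hausdorff _ R) cvw cvL).
by rewrite sqrtr_sqr ger0_norm.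
Unshelve. all: by end_near. Qed.

(** Riesz representation, by minimising Q(s) = ||s||^2 - 2 l(s), which is bounded
below by - C^2. If Q(u_n) is within 1/(n+1) of the infimum, then the polynomial
t |-> Q(u_n + t s) - inf Q is nonnegative, and its discriminant gives
|<u_n, s> - l(s)| <= (n+1)^(-1/2) ||s||. Taking s = u_m - u_n shows that u is
Cauchy, and taking s to be the section at z shows that u_n(z) tends to l(z). *)
Lemma riesz_rkhs l C :
  (forall s, span s -> `|lin_ext l s| <= C * nrm s) -> rkhs Omega K l.
Proof.
move=> lC; pose Q s := nrm s ^+ 2 - 2 * lin_ext l s.
pose E := Q @` [set s | span s].
have hE : has_inf E.
  split; first by exists (Q [::]), [::].
  exists (- C ^+ 2) => _ [s /= sO <-]; have := lC s sO.
  rewrite ler_norml /Q => /andP[_ ls].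
  have := sqr_ge0 (nrm s - C); rewrite sqrrB.
  move: (nrm s) (lin_ext l s) ls => a b ls; lra.
have /choice[u uP] : forall n : nat, exists s, span s /\ Q s < inf E + n.+1%:R^-1.
  move=> n; have n0 : 0 < n.+1%:R^-1 :> R by rewrite invr_gt0.
  by have [_ [s sO <-] Qs] := inf_adherent n0 hE; exists s.
have uO n : span (u n) by case: (uP n).
pose d n : R := Num.sqrt n.+1%:R^-1.
have key n t : span t -> `|dot (u n) t - lin_ext l t| <= d n * nrm t.
  move=> tO; rewrite -ler_sqr ?nnegrE ?mulr_ge0 ?sqrtr_ge0 ?comb_norm_ge0 //.
  rewrite real_normK ?num_real // exprMn sqr_sqrtr ?invr_ge0 // mulrC.
  apply: discriminant_le => [|c]; first exact: sqr_ge0.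
  have sO : span (u n ++ comb_scale c t).
    by apply: in_span_cat => //; exact: in_span_scale.
  have := ge_inf hE.2 (imageP Q sO).
  rewrite /Q sqr_comb_norm // lin_ext_cat lin_ext_scale.
  rewrite comb_dotDl !comb_dotDr comb_dotZl !comb_dotZr comb_dotZl.
  rewrite (comb_dotC K_adm tO (uO n)) -!sqr_comb_norm //.
  have := (uP n).2; rewrite /Q.
  move: (inf E) (nrm _ ^+ 2) (dot _ _) (nrm _ ^+ 2) (lin_ext _ _) (lin_ext _ _) (_^-1).
  by move=> i a b e f g h; nra.
have d0 : d n @[n --> \oo] --> 0.
  rewrite -(sqrtr0 R); apply: continuous_cvg; first exact: sqrt_continuous.
  exact: cvg_harmonic.
exists u; split=> // [e e0|z zO].
  have e20 : 0 < e / 2 by rewrite divr_gt0.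
  have [n0 _ n0P] := (cvgr0Pnorm_lt _).1 d0 _ e20.
  exists n0 => m n n0m n0n; apply: le_lt_trans (_ : d m + d n < e); last first.
    rewrite (splitr e) ltrD //; apply: le_lt_trans (ler_norm _) _; exact: n0P.
  set w := comb_sub _ _; have wO : span w by exact: in_span_sub.
  have [->|wn0] := eqVneq (nrm w) 0; first by rewrite addr_ge0 ?sqrtr_ge0.
  have w0 : 0 < nrm w by rewrite lt_def wn0 comb_norm_ge0.
  rewrite -(ler_pM2r w0) -expr2 sqr_comb_norm // {1}/w comb_dotBl.
  have := key m w wO; have := key n w wO; rewrite !ler_norml.
  by rewrite mulrDl => /andP[? ?] /andP[? ?]; lra.
have zs : span [:: (1, z)] by move=> p; rewrite inE => /eqP ->.
have lz : l z = lin_ext l [:: (1, z)] by rewrite /lin_ext big_seq1 mul1r.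
have cv0 : d n * nrm [:: (1, z)] @[n --> \oo] --> 0.
  by rewrite -(mul0r (nrm [:: (1, z)])); apply: cvgM d0 (cvg_cst _).
have cvl : comb_fun K (u n) z - l z @[n --> \oo] --> 0.
  apply: norm_cvg0; apply: squeeze_cvgr _ (cvg_cst 0) cv0.
  by near=> n; rewrite normr_ge0 /= comb_fun_dot // lz key.
by move/subr_cvg0: cvl.
Unshelve. all: by end_near. Qed.

(** Cauchy-Schwarz against u_n, in the limit: the dual norm of phi is at most its
norm. *)
Lemma rkhs_lin_ext_le phi s : rkhs Omega K phi -> span s ->
  `|lin_ext phi s| <= rkhs_norm Omega K phi * nrm s.
Proof.
move=> [u uphi] sO; have uO := let: And3 uO _ _ := uphi in uO.
apply: ler_cvg_to (cvg_norm (represents_dot_cvg uphi sO)) _ _; last first.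
  by near=> n; exact: comb_CauchySchwarz _ _ (uO n) sO.
by apply: cvgM (represents_norm uphi) (cvg_cst _).
Unshelve. all: by end_near. Qed.

(** Since <u_n, u_n> tends to ||phi||^2, it suffices to replace the first u_n by
phi, at the cost of e ||u_n||. *)
Lemma represents_lin_ext_cvg u phi : represents Omega K u phi ->
  lin_ext phi (u n) @[n --> \oo] --> rkhs_norm Omega K phi ^+ 2.
Proof.
move=> uphi; have uO := let: And3 uO _ _ := uphi in uO.
have cN := represents_norm uphi.
set nu := rkhs_norm Omega K phi in cN *; have nu0 : 0 <= nu by exact: sqrtr_ge0.
have diff0 : dot (u n) (u n) - lin_ext phi (u n) @[n --> \oo] --> 0.
  apply/cvgr0Pnorm_le => e e0.
  have e'0 : 0 < e / (nu + 1) by rewrite divr_gt0 // ltr_wpDl.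
  near=> n; apply: le_trans (_ : e / (nu + 1) * nrm (u n) <= _).
    have un t : span t -> `|dot (u n) t - lin_ext phi t| <= e / (nu + 1) * nrm t.
      move: t; near: n; have := represents_dot_uniform uphi e'0; exact.
    exact/un/uO.
  rewrite -mulrA ger_pMr // mulrC ler_pdivrMr ?ltr_wpDl // mul1r.
  near: n; have n1 : nu < nu + 1 by rewrite ltrDl.
  have := @cvgr_le R _ _ _ _ _ cN _ n1; exact.
rewrite -[_ ^+ 2]subr0; under eq_cvg => n do
  rewrite -(subKr (dot (u n) (u n)) (lin_ext _ _)).
apply: cvgB diff0; under eq_cvg => n do rewrite -sqr_comb_norm // expr2.
by rewrite expr2; exact: cvgM.
Unshelve. all: by end_near. Qed.

End Hilbert.

(** * Borel sets and Lebesgue measure *)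

(** A second-countability argument, stated for a family M of sets rather than for
a sigma-algebra on T so as to apply both to row vectors and to pairs of them. *)
Lemma open_of_dense_balls (R : realType) (T : pseudoMetricType R) (I : countType)
    (c : I -> T) (M : set (set T)) :
  (forall x e, 0 < e -> exists i, ball (c i) e x) ->
  (forall i e, 0 < e -> M (ball (c i) e)) ->
  M set0 -> (forall F : nat -> set T, (forall k, M (F k)) -> M (\bigcup_k F k)) ->
  forall U, open U -> M U.
Proof.
move=> cdense Mball M0 MU U oU.
(* The balls of radius 1 / n.+1 centred at the points of c form a basis. *)
pose V (p : I * nat) := ball (c p.1) p.2.+1%:R^-1.
pose F k := if unpickle k is Some p then if `[< V p `<=` U >] then V p else set0
            else set0.
have -> : U = \bigcup_k F k.
  apply/seteqP; split=> [x Ux|x [k _]]; last first.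
    by rewrite /F; case: unpickle => [p|]//; case: asboolP => // pU /pU.
  have /nbhs_ballP[e /= e0 xeU] : nbhs x U by exact: open_nbhs_nbhs.
  have [n _ /(_ n (leqnn n)) /= ne] 
    := near_infty_natSinv_lt (PosNum (divr_gt0 e0 (ltr0n R 2))).
  have n0 : 0 < n.+1%:R^-1 :> R by rewrite invr_gt0.
  have [i ix] := cdense x _ n0; exists (pickle (i, n)) => //.
  rewrite /F pickleK; case: asboolP => //; case=> y iy; apply: xeU.
  apply: ball_splitr; apply: le_ball (ltW ne) _ _; [exact: ix|exact: iy].
apply: MU => k; rewrite /F; case: unpickle => [p|]//.
by case: asboolP => // _; exact: Mball.
Qed.

Section row_borel.
Context {R : realType} {n : nat}.

Lemma rat_row_dense (x : 'rV[R]_n) e : 0 < e ->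
  exists q : 'rV[rat]_n, ball (map_mx ratr q : 'rV[R]_n) e x.
Proof.
move=> e0; have /choice[q qP] : forall i, exists q : rat, ball (ratr q : R) e (x ord0 i).
  move=> i; have [|q] := @rat_in_itvoo R (x ord0 i - e) (x ord0 i + e); first by lra.
  rewrite in_itv /= => /andP[? ?]; exists q.
  by rewrite /ball /= ltr_norml; lra.
exists (\row_i q i); split=> // i j.
by rewrite !mxE (ord1 i); exact: qP.
Qed.

Lemma measurable_row_ball (x : 'rV[R]_n) e : measurable (ball x e).
Proof.
have [e0|e0] := ltP 0 e; last first.
  rewrite (_ : ball x e = set0) //; apply/seteqP; split=> // y [].
  by rewrite ltNge e0.
rewrite (_ : ball x e =
    \bigcap_(i in [set: 'I_n])
      ((fun v => v ord0 i : measurableTypeR R) @^-1` ball (x ord0 i) e)).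
  apply: fin_bigcap_measurable => // i _; rewrite -[X in measurable X]setTI.
  by apply: measurable_coor => //; apply: open_measurable; exact: ball_open.
apply/seteqP; split=> [y [_ xy] i _|y xy]; first exact: xy.
by split=> // i j; rewrite (ord1 i); exact: xy.
Qed.

Lemma open_measurable_row (U : set 'rV[R]_n) : open U -> measurable U.
Proof.
apply: (open_of_dense_balls rat_row_dense).
- by move=> *; exact: measurable_row_ball.
- exact: measurable0.
- by move=> F mF; exact: bigcup_measurable.
Qed.

End row_borel.

Lemma open_measurable_row2 (R : realType) n m (U : set ('rV[R]_n * 'rV[R]_m)) :
  open U -> measurable U.
Proof.
apply: (@open_of_dense_balls R ('rV[R]_n * 'rV[R]_m)%type ('rV[rat]_n * 'rV[rat]_m)%type
  (fun q => (map_mx ratr q.1, map_mx ratr q.2)) measurable).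
- move=> [x1 x2] e e0; have [q1 q1x] := rat_row_dense x1 e0.
  by have [q2 q2x] := rat_row_dense x2 e0; exists (q1, q2).
- move=> [q1 q2] e e0; exact: (measurableX
    (measurable_row_ball (map_mx ratr q1) e) (measurable_row_ball (map_mx ratr q2) e)).
- exact: measurable0.
- by move=> F mF; exact: bigcup_measurable.
Qed.

Lemma within_continuous_measurable (R : realType) n m (A : set ('rV[R]_n * 'rV[R]_m))
    (f : 'rV[R]_n * 'rV[R]_m -> R) :
  measurable A -> {within A, continuous f} -> measurable_fun A f.
Proof.
move=> mA /continuousP cf; apply: (measurability _ (RGenOpens.measurableE R)).
move=> _ [_ [a [b ->] <-]].
have /open_subspaceP[V oV VA] := cf _ (@interval_open R (BRight a) (BLeft b) isT isT).
rewrite setIC -VA; apply: measurableI => //; exact: open_measurable_row2.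
Qed.

Lemma measurable_box (R : realType) m (M : R) :
  measurable [set v : 'rV[R]_m | forall i, `|v ord0 i| <= M].
Proof.
rewrite [X in measurable X](_ : _ = \bigcap_(i in [set: 'I_m])
    ((fun v : 'rV[R]_m => v ord0 i : measurableTypeR R) @^-1` [set` `[- M, M]])).
  apply: fin_bigcap_measurable => // i _; rewrite -[X in measurable X]setTI.
  by apply: measurable_coor => //; exact: measurable_itv.
apply/seteqP; split=> [y yM i _|y yM i] /=; first by rewrite in_itv /= -ler_norml.
by have := yM i I; rewrite /= in_itv /= -ler_norml.
Qed.

(** Peeling off one coordinate maps a box of dimension n.+1 into the product of a
box of dimension n and an interval. *)
Lemma box_finite (R : realType) n (M : R) :
  (lebesgue_row n [set v : 'rV[R]_n | forall i, (`|v ord0 i| <= M)%R] < +oo)%E.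
Proof.
elim: n => [|n IHn]; first by rewrite /= diracE; case: (_ \in _); rewrite ?ltry.
have mitv : measurable ([set` `[- M, M]] : set (measurableTypeR R)).
  exact: measurable_itv.
pose B := [set v : 'rV[R]_n | forall i, `|v ord0 i| <= M] `*` [set` `[- M, M]].
have mB : measurable B by apply: measurableX; [exact: measurable_box|].
rewrite /= /extend_row /pushforward.
apply: le_lt_trans (_ : (lebesgue_row n \x lebesgue_measure)%E B < +oo)%E.
  apply: le_measure; rewrite ?inE //.
    by rewrite -[X in measurable X]setTI; apply: measurable_rcons_row => //;
      exact: measurable_box.
  move=> [v a] /= H; split=> [i|] /=.
    by have := H (lift ord_max i); rewrite mxE liftK.
  by have := H ord_max; rewrite mxE unlift_none in_itv /= -ler_norml.
rewrite /B product_measure1E //; last exact: measurable_box.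
apply: lte_mul_pinfty; rewrite ?ge0_fin_numE //.
rewrite [X in (X < _)%E](lebesgue_measure_itv `[- M, M]%R).
by case: ifP => _; exact: ltry.
Qed.

Lemma bounded_set_finite (R : realType) n (A : set 'rV[R]_n) :
  measurable A -> bounded_set A -> (lebesgue_row n A < +oo)%E.
Proof.
move=> mA [M [_ AM]]; have := @box_finite R n (M + 1); apply: le_lt_trans.
apply: le_measure; rewrite ?inE //; first exact: measurable_box.
move=> x Ax i; have := AM (M + 1) _ x Ax; rewrite ltrDl ltr01 => /(_ isT).
apply: le_trans; rewrite /Num.norm /= mx_normrE.
exact: (le_bigmax _ (fun ij : 'I_1 * 'I_n => `|x ij.1 ij.2|) (ord0, i)).
Qed.

Section Rintegral_Fubini.
Context d1 d2 (T1 : measurableType d1) (T2 : measurableType d2) (R : realType).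
Variable m1 : {sigma_finite_measure set T1 -> \bar R}.
Variable m2 : {sigma_finite_measure set T2 -> \bar R}.

(** Fubini on a rectangle. Integrability of every section is assumed so that the
inner real-valued integrals agree with the extended ones at every point, not
just almost everywhere. *)
Lemma Rintegral_prod (A : set T1) (B : set T2) (f : T1 * T2 -> R) :
  measurable A -> measurable B ->
  (m1 \x m2)%E.-integrable (A `*` B) (EFin \o f) ->
  (forall x, A x -> m2.-integrable B (fun y => (f (x, y))%:E)) ->
  \int[(m1 \x m2)%E]_(p in A `*` B) f p = \int[m1]_(x in A) \int[m2]_(y in B) f (x, y).
Proof.
move=> mA mB fi fxi; rewrite /Rintegral integral_mkcond.
rewrite -integral12_prod_meas1; last exact/(integrable_mkcond _ (measurableX mA mB)).
rewrite [in RHS]integral_mkcond; congr fine; apply: eq_integral => x _.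
rewrite /fubini_F patchE; case: ifPn => [|]; rewrite ?(inE, notin_setE) => Ax.
  rewrite fineK; last by apply: integrable_fin_num => //; exact: fxi.
  rewrite [RHS]integral_mkcond; apply: eq_integral => y _; rewrite !patchE.
  have -> : ((x, y) \in A `*` B) = (y \in B).
    by apply/idP/idP; rewrite !inE; [case|split].
  by [].
rewrite integral0_eq // => y _; rewrite patchE ifF //.
by apply/negP; rewrite inE => -[].
Qed.

End Rintegral_Fubini.

(** * Bounded measurable functions *)

Section BoundedMeasurable.
Context d (T : measurableType d) (R : realType).
Implicit Types (A : set T) (f g : T -> R).

(** A class of functions stable under all the operations used below and
integrable over sets of finite measure, which spares separate integrability
proofs. *)
Definition bounded_measurable A f :=
  measurable_fun A f /\ exists M, forall x, A x -> `|f x| <= M.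

Lemma bounded_measurable_cst A (c : R) : bounded_measurable A (fun=> c).
Proof. by split; [exact: measurable_cst|exists `|c|]. Qed.

Lemma bounded_measurableZ A c f : bounded_measurable A f ->
  bounded_measurable A (fun x => c * f x).
Proof.
move=> [mf [M fM]]; split; first exact: measurable_funM.
by exists (`|c| * M) => x Ax; rewrite normrM ler_wpM2l // fM.
Qed.

Lemma bounded_measurableD A f g : bounded_measurable A f ->
  bounded_measurable A g -> bounded_measurable A (fun x => f x + g x).
Proof.
move=> [mf [M fM]] [mg [P gP]]; split; first exact: measurable_funD.
by exists (M + P) => x Ax; apply: le_trans (ler_normD _ _) _; rewrite lerD ?fM ?gP.
Qed.

Lemma bounded_measurableB A f g : bounded_measurable A f ->
  bounded_measurable A g -> bounded_measurable A (fun x => f x - g x).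
Proof.
move=> bf bg; rewrite (_ : (fun _ => _) = (fun x => f x + -1 * g x)).
  exact/bounded_measurableD/bounded_measurableZ.
by apply/funext => x; rewrite mulN1r.
Qed.

Lemma eq_bounded_measurable A f g : (forall x, A x -> f x = g x) ->
  bounded_measurable A f -> bounded_measurable A g.
Proof.
move=> fg [mf [M fM]]; split; last by exists M => x Ax; rewrite -fg ?fM.
by apply: eq_measurable_fun mf => x; rewrite inE => /fg.
Qed.

Lemma bounded_measurable_integrable (mu : {measure set T -> \bar R}) A f :
  measurable A -> (mu A < +oo)%E -> bounded_measurable A f ->
  mu.-integrable A (EFin \o f).
Proof.
move=> mA muA [mf [M fM]]; apply: measurable_bounded_integrable => //.
by exists M; split; [exact: num_real|move=> r Mr x /fM /le_trans; apply; exact: ltW].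
Qed.

Lemma normr_Rintegral_le (mu : {measure set T -> \bar R}) A f c :
  measurable A -> (mu A < +oo)%E -> bounded_measurable A f ->
  (forall x, A x -> `|f x| <= c) ->
  `|\int[mu]_(x in A) f x| <= c * fine (mu A).
Proof.
move=> mA muA bf fc; have fi := bounded_measurable_integrable mA muA bf.
apply: le_trans (le_normr_Rintegral mA fi) _; rewrite -Rintegral_cst //.
apply: le_Rintegral => //; first exact: integrable_norm.
by apply: bounded_measurable_integrable => //; exact: bounded_measurable_cst.
Qed.

Lemma Rintegral_bmD (mu : {measure set T -> \bar R}) A f g :
  measurable A -> (mu A < +oo)%E -> bounded_measurable A f -> bounded_measurable A g ->
  \int[mu]_(x in A) (f x + g x) = \int[mu]_(x in A) f x + \int[mu]_(x in A) g x.
Proof. by move=> *; rewrite RintegralD //; exact: bounded_measurable_integrable. Qed.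

Lemma Rintegral_bmB (mu : {measure set T -> \bar R}) A f g :
  measurable A -> (mu A < +oo)%E -> bounded_measurable A f -> bounded_measurable A g ->
  \int[mu]_(x in A) (f x - g x) = \int[mu]_(x in A) f x - \int[mu]_(x in A) g x.
Proof. by move=> *; rewrite RintegralB //; exact: bounded_measurable_integrable. Qed.

End BoundedMeasurable.

Lemma bounded_measurable_comp d d' (T : measurableType d) (T' : measurableType d')
    (R : realType) (B : set T') (A : set T) (h : T' -> T) (f : T -> R) :
  measurable A -> measurable_fun setT h -> h @` B `<=` A ->
  bounded_measurable A f -> bounded_measurable B (f \o h).
Proof.
move=> mA mh hBA [mf [M fM]]; split.
  by apply: measurable_comp mf _ => //; exact: measurable_funTS.
by exists M => x Bx; apply/fM/hBA; exists x.
Qed.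

(** * The quadrature error *)

Section Quadrature.
Context {R : realType} {D : nat}.
Variables (Omega : set 'rV[R]_D) (K : 'rV[R]_D -> 'rV[R]_D -> R).
Variables (N : nat) (y : 'I_N -> 'rV[R]_D).
Local Notation mu := (lebesgue_row D).
Hypotheses (K_adm : admissible Omega K) (mO : measurable Omega).
Hypotheses (muO : (mu Omega < +oo)%E) (y_Omega : forall n, Omega (y n)).
Hypothesis N_gt0 : (0 < N)%N.
Local Notation BM := (bounded_measurable Omega).
Local Notation W := (fine (mu Omega)).

Definition node_mean (f : 'rV[R]_D -> R) : R := N%:R^-1 * \sum_n f (y n).
(** The mean is weighted by the volume of Omega, so that constants have no
error whatever that volume is. *)
Definition quad_err (f : 'rV[R]_D -> R) : R :=
  \int[mu]_(x in Omega) f x - W * node_mean f.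

Lemma quad_err_linear c f g : BM f -> BM g ->
  quad_err (fun x => c * f x + g x) = c * quad_err f + quad_err g.
Proof.
move=> bf bg; rewrite /quad_err /node_mean RintegralD //.
- rewrite RintegralZl //; last exact: bounded_measurable_integrable.
  by rewrite big_split -mulr_sumr /=; ring.
- exact/bounded_measurable_integrable/bounded_measurableZ.
- exact: bounded_measurable_integrable.
Qed.

Lemma quad_err_le f c : BM f -> (forall x, Omega x -> `|f x| <= c) ->
  `|quad_err f| <= c * (2 * W).
Proof.
move=> bf fc; have W0 : 0 <= W by rewrite fine_ge0.
rewrite mulr_natl mulrnAr mulr2n; apply: le_trans (ler_normB _ _) _.
apply: lerD; first exact: normr_Rintegral_le.
rewrite normrM ger0_norm // mulrC ler_wpM2r // /node_mean.
rewrite normrM ger0_norm ?invr_ge0 // ler_pdivrMl ?ltr0n //.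
apply: le_trans (ler_norm_sum _ _ _) _; apply: le_trans (ler_sum (G := fun=> c) _ _) _.
  by move=> n _; exact: fc.
by rewrite sumr_const card_ord mulr_natl.
Qed.

Lemma eq_quad_err f g : (forall x, Omega x -> f x = g x) ->
  quad_err f = quad_err g.
Proof.
move=> fg; rewrite /quad_err /node_mean; congr (_ - _ * (_ * _)).
  by apply: eq_Rintegral => x; rewrite inE => /fg.
by apply: eq_bigr => n _; exact/fg/y_Omega.
Qed.

Lemma kernel_bounded :
  exists2 M, 0 <= M & forall x z, Omega x -> Omega z -> `|K x z| <= M.
Proof.
have [M KM] := admissible_bounded K_adm; exists M => //.
pose y0 := y (Ordinal N_gt0).
by apply: le_trans (normr_ge0 (K y0 y0)) (KM _ _ _ _); exact: y_Omega.
Qed.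

Lemma kernel_measurable : measurable_fun (Omega `*` Omega) (fun p => K p.1 p.2).
Proof.
apply: within_continuous_measurable; first exact: measurableX.
exact: admissible_continuous K_adm.
Qed.

Lemma kernel_bounded_measurable_l x : Omega x -> BM (K^~ x).
Proof.
move=> xO; split; last by have [M _ KM] := kernel_bounded; exists M => z zO; exact: KM.
rewrite (_ : K^~ x = (fun p => K p.1 p.2) \o (fun z => (z, x))) //.
apply: (measurable_comp (measurableX mO mO)) => //.
- by move=> _ [z zO <-].
- exact: kernel_measurable.
- exact/measurable_funTS/pair2_measurable.
Qed.

Lemma kernel_bounded_measurable_r x : Omega x -> BM (K x).
Proof.
move=> xO; split; last by have [M _ KM] := kernel_bounded; exists M => z zO; exact: KM.
apply: eq_measurable_fun (kernel_bounded_measurable_l xO).1 => z.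
by rewrite inE => zO; rewrite (admissible_sym K_adm).
Qed.

Lemma Rintegral_kernelC x : Omega x ->
  \int[mu]_(z in Omega) K z x = \int[mu]_(z in Omega) K x z.
Proof.
by move=> xO; apply: eq_Rintegral => z; rewrite inE => zO; rewrite (admissible_sym K_adm).
Qed.

Lemma e_KE x : Omega x ->
  e_K Omega K y x = \int[mu]_(z in Omega) K x z - W * node_mean (K x).
Proof.
move=> xO; rewrite /e_K RintegralB //.
- by rewrite Rintegral_cst // [W * _]mulrC.
- exact/bounded_measurable_integrable/kernel_bounded_measurable_r.
- exact/bounded_measurable_integrable/bounded_measurable_cst.
Qed.

Lemma quad_err_kernel x : Omega x -> quad_err (K^~ x) = e_K Omega K y x.
Proof.
move=> xO; rewrite e_KE // /quad_err Rintegral_kernelC // /node_mean.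
by congr (_ - _ * (_ * _)); apply: eq_bigr => n _; rewrite (admissible_sym K_adm).
Qed.

Lemma comb_bounded_measurable s : in_span Omega s -> BM (comb_fun K s).
Proof.
elim: s => [|p s IHs] sO.
  rewrite (_ : comb_fun K [::] = fun=> 0); first exact: bounded_measurable_cst.
  by apply/funext => z; rewrite /comb_fun big_nil.
rewrite (_ : comb_fun K _ = fun z => p.1 * K z p.2 + comb_fun K s z); last first.
  by apply/funext => z; rewrite /comb_fun big_cons.
apply: bounded_measurableD; last by apply: IHs => q qs; apply: sO; rewrite inE qs orbT.
by apply/bounded_measurableZ/kernel_bounded_measurable_l/sO; rewrite mem_head.
Qed.

Lemma quad_err_comb s : in_span Omega s ->
  quad_err (comb_fun K s) = lin_ext (e_K Omega K y) s.
Proof.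
elim: s => [|p s IHs] sO.
  rewrite /lin_ext big_nil /quad_err /node_mean /comb_fun.
  under eq_Rintegral do rewrite big_nil.
  rewrite Rintegral_cst // mul0r big1 ?mulr0 ?subrr // => n _.
  by rewrite big_nil.
rewrite (_ : comb_fun K _ = fun z => p.1 * K z p.2 + comb_fun K s z); last first.
  by apply/funext => z; rewrite /comb_fun big_cons.
have pO : Omega p.2 by apply: sO; rewrite mem_head.
have sO' : in_span Omega s by move=> q qs; apply: sO; rewrite inE qs orbT.
rewrite quad_err_linear; [|exact: kernel_bounded_measurable_l|
  exact: comb_bounded_measurable].
by rewrite quad_err_kernel // IHs // /lin_ext big_cons.
Qed.

(** On a combination s the error is at most 2 |Omega| sup |s|, and by the
reproducing property sup |s| <= ||s|| sup_x sqrt(K(x, x)): the functional that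
e_K represents is bounded. *)
Lemma e_K_rkhs : rkhs Omega K (e_K Omega K y).
Proof.
have [M M0 KM] := kernel_bounded.
apply: (riesz_rkhs K_adm (C := Num.sqrt M * (2 * W))) => s sO.
rewrite -quad_err_comb // mulrAC; apply: quad_err_le.
  exact: comb_bounded_measurable.
move=> x xO; rewrite (comb_fun_dot K_adm) // mulrC.
have zs : in_span Omega [:: (1, x)] by move=> p; rewrite inE => /eqP ->.
apply: le_trans (comb_CauchySchwarz K_adm sO zs) _.
rewrite ler_wpM2l ?comb_norm_ge0 //.
rewrite /comb_norm /comb_dot !big_seq1 !mul1r; apply: ler_wsqrtr.
by apply: le_trans (ler_norm _) _; exact: KM.
Qed.

(** Pointwise limits of measurable functions are measurable; uniform convergence
gives the bound. *)
Lemma rkhs_bounded_measurable phi : rkhs Omega K phi -> BM phi.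
Proof.
move=> [u uphi]; have [uO uC uz] := uphi; have [M M0 KM] := kernel_bounded.
split; first by apply: measurable_fun_cvg uz => n; case: (comb_bounded_measurable (uO n)).
have KM' x : Omega x -> K x x <= M by move=> xO; exact/(le_trans (ler_norm _))/KM.
have [n _ /(_ n (leqnn n)) un] := represents_uniform K_adm KM' uphi ltr01.
have [_ [B uB]] := comb_bounded_measurable (uO n).
exists (1 + B) => z zO; rewrite -[phi z](subrK (comb_fun K (u n) z)).
by apply: le_trans (ler_normD _ _) _; rewrite lerD ?uB // distrC un.
Qed.

(** The convergence u_n --> phi is uniform on Omega, and the error is continuous
for the uniform norm because Omega has finite measure. *)
Lemma quad_err_cvg u phi : represents Omega K u phi ->
  lin_ext (e_K Omega K y) (u n) @[n --> \oo] --> quad_err phi.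
Proof.
move=> uphi; have [uO uC uz] := uphi; have [M M0 KM] := kernel_bounded.
have KM' x : Omega x -> K x x <= M by move=> xO; exact/(le_trans (ler_norm _))/KM.
have W0 : 0 <= W by rewrite fine_ge0.
have bphi : BM phi by apply: rkhs_bounded_measurable; exists u.
apply/cvgrPdist_le => e e0.
have d0 : 0 < e / (2 * W + 1) by rewrite divr_gt0 // ltr_wpDl // mulr_ge0.
have := represents_uniform K_adm KM' uphi d0; apply: filterS => n un.
rewrite -quad_err_comb // distrC.
have bu := comb_bounded_measurable (uO n).
have -> : quad_err (comb_fun K (u n)) - quad_err phi =
    quad_err (fun x => -1 * phi x + comb_fun K (u n) x).
  by rewrite quad_err_linear // mulN1r addrC.
apply: le_trans (quad_err_le (c := e / (2 * W + 1)) _ _) _.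
- exact/bounded_measurableD/bu/bounded_measurableZ.
- by move=> x xO; rewrite mulN1r addrC; exact: un.
- rewrite -mulrA ger_pMr // mulrC ler_pdivrMr ?ltr_wpDl ?mulr_ge0 //.
  by rewrite mul1r lerDl.
Qed.

(** Pass to the limit in |e_K(u_n)| <= ||e_K|| ||u_n||. *)
Lemma quad_err_le_rkhs phi : rkhs Omega K phi ->
  `|quad_err phi| <= rkhs_norm Omega K (e_K Omega K y) * rkhs_norm Omega K phi.
Proof.
move=> [u uphi]; have [uO _ _] := uphi.
set nu := rkhs_norm Omega K (e_K Omega K y).
have cN : nu * comb_norm K (u n) @[n --> \oo] --> nu * rkhs_norm Omega K phi.
  exact: cvgM (cvg_cst _) (represents_norm K_adm uphi).
apply: ler_cvg_to (cvg_norm (quad_err_cvg uphi)) cN _ => /=.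
by near=> n; apply: rkhs_lin_ext_le => //; exact: e_K_rkhs.
Unshelve. all: by end_near. Qed.

(** Along a sequence u representing e_K, the numbers e_K(u_n) tend to both
sides. *)
Lemma quad_err_e_K :
  quad_err (e_K Omega K y) = rkhs_norm Omega K (e_K Omega K y) ^+ 2.
Proof.
have [u ue] := e_K_rkhs.
exact: (cvg_unique (@norm_hausdorff _ R) (quad_err_cvg ue)
  (represents_lin_ext_cvg K_adm ue)).
Qed.

Lemma mean_of_double_sum (I W : R) (k : 'I_N -> R) (c : 'I_N -> 'I_N -> R) :
  (N%:R ^+ 2)^-1 * \sum_n \sum_m (I + W ^+ 2 * c n m - W * k n - W * k m) =
  I - 2 * W * (N%:R^-1 * \sum_n k n) +
    W ^+ 2 * (N%:R^-1 * \sum_n (N%:R^-1 * \sum_m c n m)).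
Proof.
have N0 : N%:R != 0 :> R by rewrite pnatr_eq0 -lt0n.
have sumC (c' : R) : \sum_(n < N) c' = N%:R * c' by rewrite sumr_const card_ord mulr_natl.
rewrite (eq_bigr (fun n => N%:R * I + W ^+ 2 * (\sum_m c n m) - N%:R * (W * k n)
    - W * \sum_m k m)); last first.
  by move=> n _; rewrite !sumrB big_split /= !sumC -!mulr_sumr.
rewrite !sumrB big_split /= !sumC -!mulr_sumr.
move: (\sum_n k n) (\sum_n \sum_m c n m) W => u v w.
by field.
Qed.

(** With k(z) = int_Omega K(z, x) dx, both sides equal
int k - 2 |Omega| mean k + |Omega|^2 mean_n mean_m K(y^n, y^m), where the means
are taken over the nodes. *)
Lemma E_K_sqE : E_K_sq Omega K y = quad_err (e_K Omega K y).
Proof.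
pose k z := \int[mu]_(x in Omega) K z x.
(* The node mean is itself a combination, so its error is given by
   [quad_err_comb]. *)
pose s0 := [seq (N%:R^-1 : R, y n) | n <- enum 'I_N].
have s0O : in_span Omega s0 by move=> _ /mapP[n _ ->]; exact: y_Omega.
have lin_ext_s0 l : lin_ext l s0 = node_mean l.
  by rewrite /lin_ext /s0 big_map big_enum /node_mean mulr_sumr.
have bg : BM (fun z => node_mean (K z)).
  rewrite (_ : (fun z => _) = comb_fun K s0); first exact: comb_bounded_measurable.
  by apply/funext => z; rewrite -lin_ext_s0.
have ek z : Omega z -> e_K Omega K y z = k z - W * node_mean (K z) by exact: e_KE.
(* k differs from e_K, an element of H_K, by a combination. *)
have bk : BM k.
  apply: eq_bounded_measurable (bounded_measurableD
    (rkhs_bounded_measurable e_K_rkhs) (bounded_measurableZ W bg)) => z zO.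
  by rewrite ek // subrK.
have quadE : quad_err (e_K Omega K y) = \int[mu]_(z in Omega) k z
    - 2 * W * node_mean k + W ^+ 2 * node_mean (fun z => node_mean (K z)).
  rewrite (@eq_quad_err _ (fun z => - W * node_mean (K z) + k z)); last first.
    by move=> z zO; rewrite ek // mulNr addrC.
  rewrite quad_err_linear //.
  have -> : quad_err (fun z => node_mean (K z)) = node_mean (e_K Omega K y).
    rewrite -lin_ext_s0 -quad_err_comb //; congr quad_err.
    by apply/funext => z; rewrite -lin_ext_s0.
  have -> : node_mean (e_K Omega K y) =
      node_mean k - W * node_mean (fun z => node_mean (K z)).
    rewrite /node_mean [W * _]mulrCA -mulrBr [W * _]mulr_sumr -sumrB; congr (_ * _).
    by apply: eq_bigr => n _; exact: ek.
  by rewrite /quad_err; ring.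
rewrite quadE /E_K_sq.
have termE n m : \int[(mu \x mu)%E]_(p in Omega `*` Omega)
    (K p.1 p.2 + K (y n) (y m) - K (y n) p.2 - K p.1 (y m)) =
  \int[mu]_(z in Omega) k z + W ^+ 2 * K (y n) (y m) - W * k (y n) - W * k (y m).
  have bc c : BM (fun=> c) by exact: bounded_measurable_cst.
  have bK1 x : Omega x -> BM (K^~ x) by exact: kernel_bounded_measurable_l.
  have bK2 x : Omega x -> BM (K x) by exact: kernel_bounded_measurable_r.
  have bD := bounded_measurableD; have bB := bounded_measurableB.
  have RD := Rintegral_bmD; have RB := Rintegral_bmB.
  rewrite Rintegral_prod //=.
  - rewrite (@eq_Rintegral _ _ _ _ _
      (fun z => k z + W * K (y n) (y m) - k (y n) - W * K z (y m))); last first.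
      move=> z; rewrite inE => zO; rewrite !RB ?RD ?Rintegral_cst //; auto.
      by rewrite ![W * _]mulrC.
    rewrite !RB ?RD ?Rintegral_cst ?RintegralZl ?Rintegral_kernelC //; auto.
    + by rewrite -/(k (y n)) -/(k (y m)); ring.
    + by apply: bounded_measurable_integrable => //; auto.
    + exact/bounded_measurableZ/bK1.
  - apply: bounded_measurable_integrable; first exact: measurableX mO mO.
      by rewrite [X in (X < _)%E](product_measure1E mu mu mO mO)
        lte_mul_pinfty // ge0_fin_numE.
    have bP1 f : BM f -> bounded_measurable (Omega `*` Omega) (fun p => f p.1).
      by apply: bounded_measurable_comp; [|exact: measurable_fst|move=> _ [p [? ?] <-]].
    have bP2 f : BM f -> bounded_measurable (Omega `*` Omega) (fun p => f p.2).
      by apply: bounded_measurable_comp; [|exact: measurable_snd|move=> _ [p [? ?] <-]].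
    apply: bounded_measurableB; last exact: bP1 _ (bK1 _ (y_Omega m)).
    apply: bounded_measurableB; last exact: bP2 _ (bK2 _ (y_Omega n)).
    apply: bounded_measurableD; last exact: bounded_measurable_cst.
    by split; [exact: kernel_measurable|
      have [M _ KM] := kernel_bounded; exists M => p [? ?]; exact: KM].
  - by move=> x xO; apply: bounded_measurable_integrable => //; auto 6.
under eq_bigr do under eq_bigr do rewrite termE.
exact: mean_of_double_sum.
Qed.

End Quadrature.

Theorem proposition5p1 (R : realType) (D : nat) (Omega : set 'rV[R]_D)
    (K : 'rV[R]_D -> 'rV[R]_D -> R)
    (Omega_open : open Omega) (Omega_bounded : bounded_set Omega)
    (K_admissible : admissible Omega K)
    (N : nat) (N_gt0 : (0 < N)%N) (y : 'I_N -> 'rV[R]_D)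
    (y_Omega : forall n, Omega (y n)) :
  [/\ lebesgue_row D Omega = 1%E ->
        forall phi, rkhs Omega K phi ->
        `| \int[lebesgue_row D]_(x in Omega) phi x
           - N%:R^-1 * \sum_n phi (y n) |
        <= E_K Omega K y * rkhs_norm Omega K phi,
      forall phi, rkhs Omega K phi ->
        `| \int[lebesgue_row D]_(x in Omega) phi x
           - fine (lebesgue_row D Omega) * (N%:R^-1 * \sum_n phi (y n)) |
        <= E_K Omega K y * rkhs_norm Omega K phi,
      0 <= E_K_sq Omega K y,
      rkhs Omega K (e_K Omega K y) &
      E_K Omega K y = rkhs_norm Omega K (e_K Omega K y)].
Proof.
have mO : measurable Omega := open_measurable_row Omega_open.
have muO := bounded_set_finite mO Omega_bounded.
have E_KE : E_K Omega K y = rkhs_norm Omega K (e_K Omega K y).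
  rewrite /E_K (E_K_sqE K_admissible) // (quad_err_e_K K_admissible) //.
  by rewrite sqrtr_sqr ger0_norm ?sqrtr_ge0.
have main phi : rkhs Omega K phi ->
    `| \int[lebesgue_row D]_(x in Omega) phi x
       - fine (lebesgue_row D Omega) * (N%:R^-1 * \sum_n phi (y n)) |
    <= E_K Omega K y * rkhs_norm Omega K phi.
  by rewrite E_KE; exact: (quad_err_le_rkhs K_admissible).
split=> //.
- by move=> O1 phi /main; rewrite O1 mul1r.
- by rewrite (E_K_sqE K_admissible) // (quad_err_e_K K_admissible) // sqr_ge0.
- exact: (e_K_rkhs K_admissible).
Qed.
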